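(* Fix reals $\lambda_0>0$ and $a>0$ and define, for $k=0,1,2,\dots$, functions $\psi_k:V\to\mathbb{R}$ and reals $\lambda_{k+1}$ by $$\psi_k(1)=-a,\qquad \psi_k(i+1)=\psi_k(i)+\frac{\{[\psi_k(i)-\psi_k(i-1)]\nu(i-1,i)-\lambda_k\pi(i)\psi_k(i)\}^+}{\nu(i,i+1)}\quad(1\le i<n),$$ $$\lambda_{k+1}=\frac{\mathcal{E}_\nu(\psi_k,\psi_k)}{\mathrm{Var}_\pi(\psi_k)}.$$ If $n=2$, then $\lambda_k=\lambda^G_{\pi,\nu}$ for all $k\ge 1$. If $n\ge 3$, then: (1) if $\lambda_0=\lambda^G_{\pi,\nu}$, then $\lambda_k=\lambda^G_{\pi,\nu}$ for all $k\ge 0$; (2) if $\lambda_0\ne\lambda^G_{\pi,\nu}$, then $\lambda_k>\lambda_{k+1}>\lambda^G_{\pi,\nu}$ for all $k\ge 1$; (3) the limit $(\lambda^*,\psi^* )=\lim_{k\to\infty}(\lambda_k,\psi_k)$ exists and satisfies $\lambda^*=\mathcal{E}_\nu(\psi^*,\psi^* )/\mathrm{Var}_\pi(\psi^* )=\lambda^G_{\pi,\nu}$ and $\pi(\psi^* )=0$.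
   Context: Let $n\ge2$, $V=\{1,\dots,n\}$, $E=\{\{i,i+1\}:1\le i\le n-1\}$ and $G=(V,E)$. Let $\pi$ be a positive measure on $V$ with $\pi(V)=\sum_{i}\pi(i)=1$ and $\nu$ a positive measure on $E$ (write $\nu(i,i+1)=\nu(i+1,i)>0$), with the convention $\nu(0,1)=\nu(n,n+1)=0$ (so terms multiplied by these coefficients vanish). For functions $f,g$ on $V$ put $\pi(f)=\sum_i f(i)\pi(i)$, $\mathcal{E}_\nu(f,g)=\sum_{i=1}^{n-1}[f(i)-f(i+1)][g(i)-g(i+1)]\nu(i,i+1)$ and $\mathrm{Var}_\pi(f)=\pi(f^2)-\pi(f)^2$. The spectral gap is $\lambda^G_{\pi,\nu}=\min\{\mathcal{E}_\nu(f,f)/\mathrm{Var}_\pi(f): f \text{ non-constant}\}$. Notation: $t^+=\max\{t,0\}$. *)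

(* Defs.v *)
From mathcomp Require Import all_boot all_order all_algebra.
From mathcomp Require Import all_classical all_reals.
From mathcomp Require Import topology normedtype sequences.

Set Implicit Arguments.
Unset Strict Implicit.
Unset Printing Implicit Defensive.

Import Order.TTheory GRing.Theory Num.Theory.
Import numFieldNormedType.Exports.

Local Open Scope classical_set_scope.
Local Open Scope ring_scope.

(* The path on {1, ..., n}: the vertex i is the ordinal i - 1 of 'I_n, and the
   edge {i, i + 1} is the ordinal i - 1 of 'I_n.-1.  In the 0-based numbering
   the edge j joins the vertices j and j + 1. *)

Lemma edge_hi_subproof n (j : 'I_n.-1) : (j.+1 < n)%N.
Proof. by case: n j => [|n] [j]. Qed.

Definition edge_lo n (j : 'I_n.-1) : 'I_n := widen_ord (leq_pred n) j.
Definition edge_hi n (j : 'I_n.-1) : 'I_n := Ordinal (edge_hi_subproof j).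

Section Path.
Context {R : realType} {n : nat}.
Variables (pi : 'I_n -> R) (nu : 'I_n.-1 -> R).
Implicit Types (f g : 'I_n -> R).

Definition mean f : R := \sum_i f i * pi i.

Definition dirichlet f g : R :=
  \sum_(j < n.-1) (f (edge_lo j) - f (edge_hi j)) *
                  (g (edge_lo j) - g (edge_hi j)) * nu j.

Definition variance f : R := mean (fun i => f i ^+ 2) - mean f ^+ 2.

Definition rayleigh f : R := dirichlet f f / variance f.

Definition nonconstant f : Prop := exists i j, f i != f j.

Definition rayleigh_values : set R := [set rayleigh f | f in nonconstant].

(* The intersection with lbound is the set of minimum elements, which has at
   most one point; 0 is the junk value for a set without minimum. *)
Definition spectral_gap : R := xget 0 (rayleigh_values `&` lbound rayleigh_values).

End Path.

Definition ext0 {R : realType} {m : nat} (f : 'I_m -> R) (i : nat) : R :=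
  oapp f 0 (insub i).

Section Iteration.
Context {R : realType} {n : nat}.
Variables (pi : 'I_n -> R) (nu : 'I_n.-1 -> R) (a : R).

(* At the first vertex the term [psi(i) - psi(i - 1)] nu(i - 1, i) is 0, by the
   convention nu(0, 1) = 0. *)
Fixpoint psi_nat (l : R) (i : nat) : R :=
  if i is i'.+1 then
    psi_nat l i' +
    Num.max
      ((if i' is i''.+1 then (psi_nat l i' - psi_nat l i'') * ext0 nu i'' else 0)
       - l * ext0 pi i' * psi_nat l i') 0
    / ext0 nu i'
  else - a.

Definition psi_of (l : R) : 'I_n -> R := fun i => psi_nat l i.

Fixpoint lambda_seq (l0 : R) (k : nat) : R :=
  if k is k'.+1 then rayleigh pi nu (psi_of (lambda_seq l0 k')) else l0.

Definition psi_seq (l0 : R) (k : nat) : 'I_n -> R := psi_of (lambda_seq l0 k).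

End Iteration.

(* Main.v *)
Require Import Defs.
From mathcomp Require Import all_boot all_order all_algebra.
From mathcomp Require Import all_classical all_reals.
From mathcomp Require Import topology normedtype sequences.
From mathcomp Require Import ring lra.
Set Implicit Arguments.
Unset Strict Implicit.
Unset Printing Implicit Defensive.
Import Order.TTheory GRing.Theory Num.Theory.
Import numFieldNormedType.Exports.
Local Open Scope classical_set_scope.
Local Open Scope ring_scope.

(** Write psi_l for the function built from l, mu(l) for its mean, and F_j for
its flux (psi_l(j+1) - psi_l(j)) nu_j.  Without the truncation at 0, F_j would
be S_j = - l * sum_(i <= j) pi_i psi_l(i), and psi_l would be the solution of
the eigenvalue equation started at - a.  The truncated flux follows S_j as
long as S_j > 0; once it reaches 0, psi_l is positive and stays constant
([flux_dichotomy]).  In both regimes F_j and S_j have the same product with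
the increment of psi_l, so summation by parts gives the exact energy
([dirichlet_psi])

   E(psi_l, psi_l) = l (Var(psi_l) - mu(l) (max psi_l - mu(l))).

Hence one step of the iteration, l |-> E(psi_l, psi_l) / Var(psi_l), moves l
down when mu(l) > 0 and fixes it when mu(l) = 0.

The sign of mu(l) locates l with respect to the gap.  If mu(l) <= 0, there is
no truncation and psi_l is strictly increasing.  Write Var(f) as a sum of
pi_i pi_k (f(k) - f(i))^2 over pairs i < k, and bound each square by
Cauchy-Schwarz along the path from i to k, with the increments of psi_l as
weights.  Exchanging the sums bounds Var(f) by
a weighted sum of the (f(j+1) - f(j))^2 whose weights are at most nu_j / l:
so l Var(f) <= E(f, f) for every f ([poincare], [rayleigh_ge]).  A zero of mu
is therefore the spectral gap, attained at psi_l ([spectral_gapE]); such a zero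
exists by the intermediate value theorem, since mu(0) = - a < 0 and mu > 0
above any Rayleigh quotient ([exists_mean_zero]).  Contrapositively, mu(l) > 0
as soon as l exceeds the gap, so from there the iteration strictly decreases
([rayleigh_psi_decr]); its limit is a fixed point at or above the gap of a
continuous map, hence the gap itself ([lambda_cvg]).

It remains to see that an iterate cannot hit the gap by accident.  If psi_l
attains the gap c, equality in Cauchy-Schwarz makes the increments of psi_l
proportional to those of psi_c; with at least three vertices, comparing the
flux equations at the first two vertices forces l = c
([rayleigh_psi_neq]).  With two vertices all nonconstant functions have the
same Rayleigh quotient. *)

(** * A weighted Poincare inequality on a path *)

Section WeightedPairs.
Context {R : realFieldType}.
Implicit Types (p f w q v : nat -> R) (i j k m N : nat).

Definition partial_mean p f k : R := \sum_(i < k) f i * p i.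

Lemma partial_meanS p f k :
  partial_mean p f k.+1 = partial_mean p f k + f k * p k.
Proof. by rewrite /partial_mean big_ord_recr. Qed.

Definition partial_variance p f N : R :=
  partial_mean p (fun i => f i ^+ 2) N - partial_mean p f N ^+ 2.

Lemma sum_sq_pairs p f N :
  \sum_(k < N) \sum_(i < k) p i * p k * (f k - f i) ^+ 2 =
  (\sum_(i < N) p i) * partial_mean p (fun i => f i ^+ 2) N
  - partial_mean p f N ^+ 2.
Proof.
elim: N => [|N IH]; first by rewrite /partial_mean !big_ord0 mul0r expr0n subr0.
rewrite big_ord_recr /= IH !partial_meanS big_ord_recr /=.
suff -> : \sum_(i < N) p i * p N * (f N - f i) ^+ 2 =
   p N * (f N ^+ 2 * (\sum_(i < N) p i) - 2 * f N * partial_mean p f N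
   + partial_mean p (fun i => f i ^+ 2) N) by ring.
rewrite /partial_mean !mulr_sumr -sumrB -big_split mulr_sumr /=.
by apply: eq_bigr => i _; ring.
Qed.

(** Both sides sum b_i q_j over the triangle i <= j < N. *)
Lemma exchange_sum_triangle (b q : nat -> R) N :
  \sum_(i < N) b i * (\sum_(i <= j < N) q j) =
  \sum_(j < N) q j * (\sum_(i < j.+1) b i).
Proof.
elim: N => [|N IH]; first by rewrite !big_ord0.
rewrite [RHS]big_ord_recr /= -IH [LHS]big_ord_recr /= big_nat1.
rewrite big_ord_recr /= mulrDr addrA [b N * _]mulrC; congr (_ + _).
rewrite mulr_sumr -big_split /=; apply: eq_bigr => i _.
by rewrite big_nat_recr ?(ltnW (ltn_ord i)) //= mulrDr [q N * _]mulrC.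
Qed.

(** Exchanging the sums collects, for each edge j, the pairs i <= j < k whose
path crosses j.  For such pairs the sum of p_i p_k (w_k - w_i) factors into
products of partial sums of p and p w, which simplify to the coefficient of
q_j. *)
Lemma sum_pairs_crossing p w q m :
  \sum_(k < m.+1) \sum_(i < k)
     p i * p k * (w k - w i) * (\sum_(i <= j < k) q j) =
  \sum_(j < m) q j * ((\sum_(i < j.+1) p i) * partial_mean p w m.+1
                      - (\sum_(i < m.+1) p i) * partial_mean p w j.+1).
Proof.
elim: m => [|m IH]; first by rewrite big_ord_recl !big_ord0 addr0.
rewrite big_ord_recr IH /=.
rewrite (exchange_sum_triangle
  (fun i => p i * p m.+1 * (w m.+1 - w i)) q m.+1).
(* No pair of the first m.+1 vertices crosses the edge m, so the induction
   hypothesis can be stated with that edge included. *)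
have -> : \sum_(j < m) q j * ((\sum_(i < j.+1) p i) * partial_mean p w m.+1
              - (\sum_(i < m.+1) p i) * partial_mean p w j.+1) =
          \sum_(j < m.+1) q j * ((\sum_(i < j.+1) p i) * partial_mean p w m.+1
              - (\sum_(i < m.+1) p i) * partial_mean p w j.+1).
  by rewrite [RHS]big_ord_recr /= subrr mulr0 addr0.
rewrite -big_split /=; apply: eq_bigr => j _.
rewrite -mulrDr; congr (_ * _).
have -> : \sum_(i < j.+1) p i * p m.+1 * (w m.+1 - w i) =
    p m.+1 * (w m.+1 * (\sum_(i < j.+1) p i) - partial_mean p w j.+1).
  rewrite /partial_mean [in RHS]mulr_sumr -sumrB mulr_sumr.
  by apply: eq_bigr => i _; ring.
rewrite [partial_mean p w m.+2]partial_meanS.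
rewrite [X in _ = _ - X * _]big_ord_recr /=.
ring.
Qed.

(** The Cauchy-Schwarz defect of the pair (i, k): the sum of D_j (s_j - s)^2,
where D_j are the increments of w, s_j the slopes of f with respect to w on
the edges from i to k, and s the average slope.  Since it is a sum of squares,
equality of all slopes can be read off from its vanishing. *)
Definition cs_defect w f i k : R :=
  \sum_(i <= j < k) (w j.+1 - w j) *
    ((f j.+1 - f j) / (w j.+1 - w j) - (f k - f i) / (w k - w i)) ^+ 2.

Lemma lt_upto_steps w m : (forall j, (j < m)%N -> w j < w j.+1) ->
  forall i k, (i < k)%N -> (k <= m)%N -> w i < w k.
Proof.
move=> w_incr i; elim=> [//|k IH]; rewrite ltnS leq_eqVlt => /orP[/eqP-> km|ik km].
  exact: w_incr.
exact: lt_trans (IH ik (ltnW km)) (w_incr _ km).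
Qed.

(** Expanding the squares in the defect: the cross term and the square of the
average slope telescope. *)
Lemma cs_defectE w f i k : (i < k)%N ->
  (forall j, (j < k)%N -> w j < w j.+1) ->
  (f k - f i) ^+ 2 = (w k - w i) *
     (\sum_(i <= j < k) (f j.+1 - f j) ^+ 2 / (w j.+1 - w j) - cs_defect w f i k).
Proof.
move=> ik w_incr; have wik := lt_upto_steps w_incr ik (leqnn k).
set c := (f k - f i) / (w k - w i).
have -> : cs_defect w f i k =
    \sum_(i <= j < k) (f j.+1 - f j) ^+ 2 / (w j.+1 - w j)
    - 2 * c * (\sum_(i <= j < k) (f j.+1 - f j))
    + c ^+ 2 * (\sum_(i <= j < k) (w j.+1 - w j)).
  rewrite !mulr_sumr -sumrB -big_split /=; apply: eq_big_nat => j /andP[_ jk].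
  have := w_incr _ jk; rewrite -subr_gt0 /c => /lt0r_neq0.
  set x := (f k - f i) / (w k - w i) => D0; field.
  by rewrite D0.
rewrite !telescope_sumr ?(ltnW ik) // /c.
by field; rewrite subr_eq0 gt_eqF.
Qed.

Lemma cs_defect_ge0 w f i k : (forall j, (j < k)%N -> w j < w j.+1) ->
  0 <= cs_defect w f i k.
Proof.
move=> w_incr; rewrite /cs_defect big_nat sumr_ge0 // => j /andP[_ jk].
by rewrite mulr_ge0 ?sqr_ge0 // subr_ge0 ltW // w_incr.
Qed.

Lemma cs_defect_eq0 w f m : (forall j, (j < m)%N -> w j < w j.+1) ->
  cs_defect w f 0 m = 0 -> forall j, (j < m)%N ->
  f j.+1 - f j = (f m - f 0%N) / (w m - w 0%N) * (w j.+1 - w j).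
Proof.
move=> w_incr; rewrite /cs_defect big_mkord => d0 j jm.
have/psumr_eq0P := d0 => /(_ _ (Ordinal jm) isT) /=.
have D0 : 0 < w j.+1 - w j by rewrite subr_gt0 w_incr.
move=> H; have /eqP : (w j.+1 - w j) * ((f j.+1 - f j) / (w j.+1 - w j)
   - (f m - f 0%N) / (w m - w 0%N)) ^+ 2 = 0.
  by apply: H => i _; rewrite mulr_ge0 ?sqr_ge0 // subr_ge0 ltW // w_incr.
rewrite mulf_eq0 (gt_eqF D0) sqrf_eq0 subr_eq0 => /eqP <-.
by rewrite divfK // gt_eqF.
Qed.

(** The last hypothesis says that w is a supersolution: the weight that
Cauchy-Schwarz gives to the edge j is at most v_j / l. *)
Section Poincare.
Variables (m : nat) (p v w f : nat -> R) (l : R).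
Hypothesis p_gt0 : forall i, (i <= m)%N -> 0 < p i.
Hypothesis p_sum : \sum_(i < m.+1) p i = 1.
Hypothesis w_incr : forall j, (j < m)%N -> w j < w j.+1.
Hypothesis l_gt0 : 0 < l.
Hypothesis w_super : forall j, (j < m)%N ->
  l * ((\sum_(i < j.+1) p i) * partial_mean p w m.+1 - partial_mean p w j.+1)
  <= v j * (w j.+1 - w j).

Let defect := \sum_(k < m.+1) \sum_(i < k)
  p i * p k * (w k - w i) * cs_defect w f i k.

Let defect_term_ge0 (k : 'I_m.+1) (i : 'I_k) :
  0 <= p i * p k * (w k - w i) * cs_defect w f i k.
Proof.
have km : (k <= m)%N by rewrite -ltnS.
have ik := ltn_ord i.
apply: mulr_ge0; last first.
  by apply: cs_defect_ge0 => j jk; apply: w_incr; apply: leq_trans jk km.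
have wik : w i < w k by apply: lt_upto_steps w_incr _ _ _ _.
have im : (i <= m)%N by apply: leq_trans (ltnW ik) km.
by rewrite !mulr_ge0 ?subr_ge0 ?(ltW wik) // ltW // p_gt0.
Qed.

Let defect_row_ge0 (k : 'I_m.+1) :
  0 <= \sum_(i < k) p i * p k * (w k - w i) * cs_defect w f i k.
Proof. by apply: sumr_ge0 => i _; apply: defect_term_ge0. Qed.

(* Cauchy-Schwarz with its defect kept, summed over all pairs. *)
Let variE : partial_variance p f m.+1 + defect =
  \sum_(j < m) (f j.+1 - f j) ^+ 2 / (w j.+1 - w j) *
  ((\sum_(i < j.+1) p i) * partial_mean p w m.+1 - partial_mean p w j.+1).
Proof.
have /esym := sum_sq_pairs p f m.+1; rewrite p_sum mul1r -/(partial_variance _ _ _) => ->.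
have /esym := sum_pairs_crossing p w
  (fun j => (f j.+1 - f j) ^+ 2 / (w j.+1 - w j)) m.
under eq_bigr do rewrite p_sum mul1r; move=> ->.
rewrite -big_split; apply: eq_bigr => k _ /=.
rewrite -big_split; apply: eq_bigr => i _ /=.
rewrite (@cs_defectE w f i k) //; first by ring.
by move=> j jk; apply: w_incr; apply: leq_trans jk _; rewrite -ltnS.
Qed.

Lemma poincare_defect :
  l * (partial_variance p f m.+1 + defect) <= \sum_(j < m) (f j.+1 - f j) ^+ 2 * v j.
Proof.
rewrite variE mulr_sumr ler_sum // => j _.
have D0 : 0 < w j.+1 - w j by rewrite subr_gt0 w_incr.
rewrite mulrCA -mulrA ler_wpM2l ?sqr_ge0 //.
by rewrite mulrC ler_pdivrMr // w_super.
Qed.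

Lemma poincare :
  l * partial_variance p f m.+1 <= \sum_(j < m) (f j.+1 - f j) ^+ 2 * v j.
Proof.
apply: le_trans poincare_defect; rewrite ler_pM2l // lerDl.
by apply: sumr_ge0 => k _.
Qed.

(** In the equality case the total defect vanishes, in particular that of the
pair of endpoints, whose path uses every edge. *)
Lemma poincare_eq : (0 < m)%N ->
  \sum_(j < m) (f j.+1 - f j) ^+ 2 * v j = l * partial_variance p f m.+1 ->
  forall j, (j < m)%N ->
  f j.+1 - f j = (f m - f 0%N) / (w m - w 0%N) * (w j.+1 - w j).
Proof.
move=> m_gt0 eq_f; apply: cs_defect_eq0 => //.
have := poincare_defect; rewrite eq_f ler_pM2l // gerDl => defect_le0.
have defect0 : defect = 0.
  by apply/eqP; rewrite eq_le defect_le0 sumr_ge0.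
have row0 : \sum_(i < m) p i * p m * (w m - w i) * cs_defect w f i m = 0.
  by apply: (psumr_eq0P _ defect0 (i := ord_max)) => // k _.
have : p 0%N * p m * (w m - w 0%N) * cs_defect w f 0 m = 0.
  apply: (psumr_eq0P _ row0 (i := Ordinal m_gt0)) => // i _.
  exact: (@defect_term_ge0 ord_max i).
move/eqP; rewrite mulf_eq0 => /orP[|/eqP //].
rewrite gt_eqF // !mulr_gt0 ?p_gt0 ?subr_gt0 //.
exact: lt_upto_steps w_incr _ _ _ _.
Qed.

End Poincare.
End WeightedPairs.

(** * Passage to functions on the natural numbers *)

Lemma ext0_ord {R : realType} k (f : 'I_k -> R) (i : 'I_k) : ext0 f i = f i.
Proof. by rewrite /ext0 valK. Qed.

Lemma ext0_gt0 {R : realType} k (f : 'I_k -> R) i :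
  (forall i, 0 < f i) -> (i < k)%N -> 0 < ext0 f i.
Proof. by move=> f_gt0 ik; rewrite (ext0_ord f (Ordinal ik)). Qed.

Section Path.
Context {R : realType} {m : nat}.
Variables (pi : 'I_m.+1 -> R) (nu : 'I_m -> R).
Hypothesis m_gt0 : (0 < m)%N.
Hypothesis pi_gt0 : forall i, 0 < pi i.
Hypothesis pi_sum : \sum_i pi i = 1.
Hypothesis nu_gt0 : forall j, 0 < nu j.

Local Notation p := (ext0 pi).
Local Notation v := (ext0 nu).

Let p_gt0 i : (i <= m)%N -> 0 < p i.
Proof. by move=> im; apply: ext0_gt0. Qed.

Let v_gt0 j : (j < m)%N -> 0 < v j.
Proof. by move=> jm; apply: ext0_gt0. Qed.

Let p_sum : \sum_(i < m.+1) p i = 1.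
Proof. by rewrite -pi_sum; apply: eq_bigr => i _; rewrite ext0_ord. Qed.

Lemma mean_nat (F : nat -> R) :
  mean pi (fun i => F i) = partial_mean p F m.+1.
Proof. by apply: eq_bigr => i _; rewrite ext0_ord. Qed.

Lemma variance_nat (F : nat -> R) :
  variance pi (fun i => F i) = partial_variance p F m.+1.
Proof. by rewrite /variance (mean_nat (fun i => F i ^+ 2)) mean_nat. Qed.

Lemma dirichlet_nat (F : nat -> R) :
  @dirichlet R m.+1 nu (fun i => F i) (fun i => F i) =
  \sum_(j < m) (F j.+1 - F j) ^+ 2 * v j.
Proof.
by apply: eq_bigr => j _; rewrite ext0_ord /=; congr (_ * _); ring.
Qed.

Lemma ext0_funE (f : 'I_m.+1 -> R) : f = (fun i => ext0 f i).
Proof. by apply/funext => i; rewrite ext0_ord. Qed.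

Lemma variance_centered (f : 'I_m.+1 -> R) :
  variance pi f = \sum_i (f i - mean pi f) ^+ 2 * pi i.
Proof.
transitivity (\sum_i (f i ^+ 2 * pi i - 2 * mean pi f * (f i * pi i)
  + mean pi f ^+ 2 * pi i)); last by apply: eq_bigr => i _; ring.
rewrite big_split sumrB -!mulr_sumr pi_sum /= -/(mean pi f) /variance.
by rewrite /(mean pi (fun _ => _)); ring.
Qed.

Lemma variance_gt0 (f : 'I_m.+1 -> R) : nonconstant f -> 0 < variance pi f.
Proof.
move=> [i [j fij]]; rewrite variance_centered.
have t_ge0 k : 0 <= (f k - mean pi f) ^+ 2 * pi k.
  by rewrite mulr_ge0 ?sqr_ge0 ?ltW.
rewrite lt_def sumr_ge0 // andbT; apply/negP => /eqP sum0.
have f_mean k : f k = mean pi f.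
  have /eqP := psumr_eq0P (fun k _ => t_ge0 k) sum0 (i := k) isT.
  by rewrite mulf_eq0 (gt_eqF (pi_gt0 k)) orbF sqrf_eq0 subr_eq0 => /eqP.
by move: fij; rewrite !f_mean eqxx.
Qed.

(** * The function built from one value of the parameter *)

Section Psi.
Variable a : R.
Hypothesis a_gt0 : 0 < a.

Local Notation psi := (psi_nat pi nu a).
Local Notation psif := (@psi_of R m.+1 pi nu a).
Local Notation mu l := (mean pi (psif l)).

Lemma mean_psi l : mu l = partial_mean p (psi l) m.+1.
Proof. exact: mean_nat. Qed.

Definition flux l j : R := (psi l j.+1 - psi l j) * v j.

(** The value that the flux through the edge j would have without truncation:
the sum over the vertices up to j of the eigenvalue equation. *)
Definition drive l j : R := - l * partial_mean p (psi l) j.+1.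

Lemma driveS l j : drive l j.+1 = drive l j - l * p j.+1 * psi l j.+1.
Proof. by rewrite /drive partial_meanS; ring. Qed.

Lemma flux0 l : 0 < l -> flux l 0 = drive l 0.
Proof.
move=> l_gt0; rewrite /flux /drive /= addrC addKr sub0r divfK ?gt_eqF ?v_gt0 //.
rewrite partial_meanS /partial_mean big_ord0 add0r /= max_l; first by ring.
by rewrite mulrN opprK ltW // !mulr_gt0 // p_gt0.
Qed.

Lemma fluxS l j : (j.+1 < m)%N ->
  flux l j.+1 = Num.max (flux l j - l * p j.+1 * psi l j.+1) 0.
Proof.
move=> jm; rewrite [LHS]/flux.
have -> : psi l j.+2 = psi l j.+1 +
  Num.max (flux l j - l * p j.+1 * psi l j.+1) 0 / v j.+1 by [].
by rewrite addrC addKr divfK // gt_eqF // v_gt0.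
Qed.

(** While the flux is positive it obeys the untruncated recursion.  When it
first vanishes, the subtracted term l p psi exceeds a positive flux, hence psi
is positive there; then psi is constant afterwards, the flux stays 0 and the
untruncated value keeps decreasing. *)
Lemma flux_dichotomy l j : 0 < l -> (j < m)%N ->
  (flux l j = drive l j /\ 0 < drive l j) \/
  [/\ flux l j = 0, 0 < psi l j & drive l j <= 0].
Proof.
move=> l_gt0; elim: j => [|j IH] jm.
  left; rewrite flux0 //; split=> //.
  rewrite /drive partial_meanS /partial_mean big_ord0 add0r /=.
  by rewrite mulrA mulrNN !mulr_gt0 // p_gt0.
have lp_gt0 : 0 < l * p j.+1 by rewrite mulr_gt0 // p_gt0 // ltnW.
rewrite fluxS // driveS; case: (IH (ltnW jm)) => [[-> d_gt0]|[f0 ps_gt0 d_le0]].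
  case: (ltP 0 (drive l j - l * p j.+1 * psi l j.+1)) => h.
    by left; split.
  right; split=> //.
  by rewrite -(pmulr_rgt0 _ lp_gt0); lra.
right; have psE : psi l j.+1 = psi l j.
  move/eqP: f0; rewrite mulf_eq0 [v j == 0]gt_eqF ?v_gt0 ?(ltnW jm) // orbF.
  by rewrite subr_eq0 => /eqP.
have h : 0 < l * p j.+1 * psi l j.+1 by rewrite mulr_gt0 // psE.
by rewrite f0 psE; split=> //; rewrite ?max_r //; rewrite -psE; lra.
Qed.

Lemma flux_ge0 l j : 0 < l -> (j < m)%N -> 0 <= flux l j.
Proof. by move=> l_gt0 /(flux_dichotomy l_gt0)[[-> /ltW]|[->]]. Qed.

Lemma psi_le l j : 0 < l -> (j < m)%N -> psi l j <= psi l j.+1.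
Proof.
move=> l_gt0 jm; have := flux_ge0 l_gt0 jm.
by rewrite pmulr_lge0 ?v_gt0 // subr_ge0.
Qed.

Lemma psi_nondecreasing l i k : 0 < l -> (i <= k <= m)%N -> psi l i <= psi l k.
Proof.
move=> l_gt0 /andP[]; elim: k => [|k IH]; first by rewrite leqn0 => /eqP->.
rewrite leq_eqVlt ltnS => /orP[/eqP->//|ik km].
exact: le_trans (IH ik (ltnW km)) (psi_le l_gt0 km).
Qed.

Lemma drive_last l : drive l m = - l * mu l.
Proof. by rewrite mean_psi. Qed.

(** Had the flux been truncated at j, psi would be positive from j on, so the
untruncated value would decrease strictly from a nonpositive value at j to
- l * mean at the last vertex, which would make the mean positive. *)
Lemma flux_of_mean_le0 l j : 0 < l -> mu l <= 0 -> (j < m)%N ->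
  flux l j = drive l j /\ 0 < drive l j.
Proof.
move=> l_gt0 mu_le0 jm.
case: (flux_dichotomy l_gt0 jm) => // -[_ psj_gt0 dj_le0].
suff : drive l m < 0 by rewrite drive_last mulNr oppr_lt0 pmulr_rgt0 // ltNge mu_le0.
have step k : (j <= k)%N -> (k < m)%N -> drive l k <= 0 -> drive l k.+1 < 0.
  move=> jk km d_le0; rewrite driveS.
  suff : 0 < l * p k.+1 * psi l k.+1 by lra.
  rewrite !mulr_gt0 ?p_gt0 // (lt_le_trans psj_gt0) // psi_nondecreasing //.
  by rewrite km (leq_trans jk).
suff : forall k, (j < k)%N -> (k <= m)%N -> drive l k < 0 by apply.
elim=> [//|k IH]; rewrite ltnS leq_eqVlt => /orP[/eqP <- km|jk km].
  exact: step.
by apply: step => //; [exact: ltnW | apply/ltW/IH => //; exact: ltnW].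
Qed.

Lemma psi_lt_of_mean_le0 l j : 0 < l -> mu l <= 0 -> (j < m)%N ->
  psi l j < psi l j.+1.
Proof.
move=> l_gt0 mu_le0 jm; have [fE d_gt0] := flux_of_mean_le0 l_gt0 mu_le0 jm.
by move: d_gt0; rewrite -fE /flux pmulr_lgt0 ?v_gt0 // subr_gt0.
Qed.

Lemma psi_nonconstant l : 0 < l -> nonconstant (psif l).
Proof.
move=> l_gt0; exists ord0, ord_max; rewrite lt_eqF // /psi_of /=.
apply: lt_le_trans (psi_nondecreasing (i := 1) l_gt0 _); last by rewrite m_gt0 leqnn.
case: (flux_dichotomy l_gt0 m_gt0) => [[fE]|[_]]; last first.
  by rewrite /= ltNge oppr_le0 ltW.
by rewrite -fE /flux pmulr_lgt0 ?v_gt0 // subr_gt0.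
Qed.

(** When the flux is truncated the increment of psi is zero, so the flux may be
replaced by its untruncated value everywhere, and Abel summation applies. *)
Lemma dirichlet_psi l : 0 < l ->
  @dirichlet R m.+1 nu (psif l) (psif l) =
  l * (variance pi (psif l) - mu l * (psi l m - mu l)).
Proof.
move=> l_gt0; rewrite (dirichlet_nat (psi l)) variance_nat mean_psi.
transitivity (\sum_(j < m) drive l j * (psi l j.+1 - psi l j)).
  apply: eq_bigr => j _; rewrite expr2 -mulrA -/(flux l j) mulrC.
  case: (flux_dichotomy l_gt0 (ltn_ord j)) => [[-> //]|[f0 _ _]].
  move/eqP: (f0); rewrite mulf_eq0 [v j == 0]gt_eqF ?v_gt0 // orbF => /eqP->.
  by rewrite !mulr0.
have abel k : \sum_(j < k) drive l j * (psi l j.+1 - psi l j) =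
    drive l k * psi l k + l * partial_mean p (fun i => psi l i ^+ 2) k.+1.
  elim: k => [|k IH].
    by rewrite big_ord0 /drive !partial_meanS /partial_mean !big_ord0; ring.
  by rewrite big_ord_recr IH driveS [X in _ = _ + _ * X]partial_meanS /=; ring.
by rewrite abel /drive /partial_variance; ring.
Qed.

Lemma mean_lt_last l : 0 < l -> mu l < psi l m.
Proof.
move=> l_gt0; rewrite -subr_gt0.
have -> : psi l m - mu l = \sum_i (psi l m - psif l i) * pi i.
  under [RHS]eq_bigr do rewrite mulrBl.
  by rewrite sumrB -mulr_sumr pi_sum mulr1.
have psi_lem (i : 'I_m.+1) : psif l i <= psi l m.
  by apply: psi_nondecreasing => //; rewrite leqnn -ltnS ltn_ord.
have t_ge0 i : 0 <= (psi l m - psif l i) * pi i.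
  by apply: mulr_ge0; [rewrite subr_ge0; exact: psi_lem | exact: ltW].
rewrite lt_def sumr_ge0 // andbT; apply/negP => /eqP sum0.
have [i [j]] := psi_nonconstant l_gt0.
suff psi_last k : psif l k = psi l m by rewrite !psi_last eqxx.
have /eqP := psumr_eq0P (fun k _ => t_ge0 k) sum0 (i := k) isT.
by rewrite mulf_eq0 (gt_eqF (pi_gt0 k)) orbF subr_eq0 => /eqP.
Qed.

Lemma rayleigh_psi l : 0 < l ->
  rayleigh pi nu (psif l) =
  l - l * mu l * (psi l m - mu l) / variance pi (psif l).
Proof.
move=> l_gt0; rewrite /rayleigh dirichlet_psi //.
have := variance_gt0 (psi_nonconstant l_gt0) => /lt0r_neq0 V0.
by field.
Qed.

Lemma rayleigh_psi_lt l : 0 < l -> 0 < mu l -> rayleigh pi nu (psif l) < l.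
Proof.
move=> l_gt0 mu_gt0; rewrite rayleigh_psi // gtrBl divr_gt0 //.
  by rewrite !mulr_gt0 // subr_gt0 mean_lt_last.
exact: variance_gt0 (psi_nonconstant l_gt0).
Qed.

Lemma rayleigh_psi_eq l : 0 < l -> mu l = 0 -> rayleigh pi nu (psif l) = l.
Proof. by move=> l_gt0 mu0; rewrite rayleigh_psi // mu0 mulr0 !mul0r subr0. Qed.

(** The left-hand side is the untruncated flux plus a nonnegative multiple of
the mean. *)
Lemma psi_supersolution l j : 0 < l -> mu l <= 0 -> (j < m)%N ->
  l * ((\sum_(i < j.+1) p i) * partial_mean p (psi l) m.+1
       - partial_mean p (psi l) j.+1) <= v j * (psi l j.+1 - psi l j).
Proof.
move=> l_gt0 mu_le0 jm; rewrite [leRHS]mulrC -/(flux l j).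
have [-> _] := flux_of_mean_le0 l_gt0 mu_le0 jm.
rewrite mulrBr /drive mulNr gerDr pmulr_rle0 // mulr_ge0_le0 -?mean_psi //.
apply: sumr_ge0 => i _; apply/ltW/p_gt0.
exact: leq_trans (leq_ord i) (ltnW jm).
Qed.

(** * The spectral gap as the zero of the mean *)

Lemma rayleigh_ge l (f : 'I_m.+1 -> R) :
  0 < l -> mu l <= 0 -> nonconstant f -> l <= rayleigh pi nu f.
Proof.
move=> l_gt0 mu_le0 f_nc; rewrite /rayleigh ler_pdivlMr ?variance_gt0 //.
rewrite (ext0_funE f) variance_nat (dirichlet_nat (ext0 f)).
apply: (poincare (w := psi l)) => // j jm.
  exact: psi_lt_of_mean_le0.
exact: psi_supersolution.
Qed.

Lemma rayleigh_eq l (f : 'I_m.+1 -> R) :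
  0 < l -> mu l = 0 -> nonconstant f -> rayleigh pi nu f = l ->
  exists c, forall j, (j < m)%N ->
    ext0 f j.+1 - ext0 f j = c * (psi l j.+1 - psi l j).
Proof.
move=> l_gt0 mu0 f_nc fE; eexists.
apply: (poincare_eq (p := p) (v := v) (l := l)) => //.
- by move=> j jm; apply: psi_lt_of_mean_le0; rewrite ?mu0.
- by move=> j jm; apply: psi_supersolution; rewrite ?mu0.
rewrite -(dirichlet_nat (ext0 f)) -variance_nat -ext0_funE -fE.
by rewrite divfK // gt_eqF // variance_gt0.
Qed.

Lemma spectral_gapE l : 0 < l -> mu l = 0 -> @spectral_gap R m.+1 pi nu = l.
Proof.
move=> l_gt0 mu0.
have lP : (rayleigh_values pi nu `&` lbound (rayleigh_values pi nu)) l.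
  split; first by exists (psif l); [exact: psi_nonconstant|exact: rayleigh_psi_eq].
  by move=> _ [f f_nc <-]; apply: rayleigh_ge; rewrite ?mu0.
apply: xget_unique => // y [y_val y_lb]; apply/eqP.
by rewrite eq_le (y_lb _ lP.1) (lP.2 _ y_val).
Qed.

Lemma psi_continuous i : continuous (fun l => psi l i).
Proof.
elim/ltn_ind: i => -[|i] IH l; first exact: cvg_cst.
rewrite /=; apply: cvgD; first exact: IH.
apply: cvgMr_tmp; pose g l := (if i is i'.+1 then (psi l i - psi l i') * v i' else 0)
  - l * p i * psi l i.
have g_cont : {for l, continuous g}.
  rewrite /g; apply: cvgB; last first.
    by apply: cvgM; [apply: cvgMr_tmp; exact: cvg_id | exact: IH].
  case: i IH {g} => [|i] IH; first exact: cvg_cst.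
  by apply: cvgMr_tmp; apply: cvgB; apply: IH.
exact: (@continuous_max R R g (fun=> 0) l g_cont (cvg_cst _)).
Qed.

Lemma mean_psi_continuous : continuous (fun l => mu l).
Proof.
move=> l; apply: cvg_big => [|i _]; first exact: add_continuous.
apply: cvgMr_tmp.
exact: psi_continuous.
Qed.

Lemma mean_psi0 : mu 0 < 0.
Proof.
suff psi0 i : psi 0 i = - a.
  rewrite /mean /psi_of; under eq_bigr do rewrite psi0.
  by rewrite -mulr_sumr pi_sum mulr1 oppr_lt0.
suff : psi 0 i = - a /\ psi 0 i.+1 = - a by case.
elim: i => [|i [IH0 IH1]]; first by rewrite /= !mul0r subrr maxxx mul0r addr0.
split=> //.
have -> : psi 0 i.+2 = psi 0 i.+1 + Num.max
  ((psi 0 i.+1 - psi 0 i) * v i - 0 * p i.+1 * psi 0 i.+1) 0 / v i.+1 by [].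
by rewrite IH0 IH1 subrr !mul0r subrr maxxx mul0r addr0.
Qed.

(** At l = 0 the function is the constant - a.  Beyond a Rayleigh quotient the
mean must be positive, for otherwise [rayleigh_ge] would make l a lower bound
of all Rayleigh quotients. *)
Lemma exists_mean_zero : exists2 l, 0 < l & mu l = 0.
Proof.
set b := rayleigh pi nu (psif 1) + 1.
have b_mu : 0 < b -> 0 < mu b.
  move=> b_gt0; rewrite ltNge; apply/negP => mu_le0.
  have := rayleigh_ge b_gt0 mu_le0 (psi_nonconstant ltr01).
  by rewrite /b gerDl ler10.
have b_gt0 : 0 < b.
  rewrite ltr_wpDl //; apply: divr_ge0; last first.
    exact/ltW/variance_gt0/psi_nonconstant.
  rewrite (dirichlet_nat (psi 1)) sumr_ge0 // => j _.
  by rewrite mulr_ge0 ?sqr_ge0 // ltW ?v_gt0.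
have mu_cont : {within `[0, b], continuous (fun l => mu l)}.
  exact/continuous_subspaceT/mean_psi_continuous.
have mu_0b : Num.min (mu 0) (mu b) <= 0 <= Num.max (mu 0) (mu b).
  by rewrite ge_min (ltW mean_psi0) le_max (ltW (b_mu b_gt0)) orbT.
have [c] := IVT (ltW b_gt0) mu_cont mu_0b.
rewrite in_itv /= => /andP[c_ge0 _] mu0; exists c => //.
rewrite lt_def c_ge0 andbT; apply/eqP => c0.
by move: mean_psi0; rewrite -[in mu _]c0 mu0 ltxx.
Qed.

(** Suppose the increments of psi_l are d times those of psi_c.  Both functions
start at - a, so the flux through the first edge gives l = d c.  The flux of
psi_c through the second edge is positive, hence so is that of psi_l, which is
therefore not truncated there; the balance at the second vertex then shows
that psi_l and psi_c also agree at that vertex, so d = 1. *)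
Lemma rayleigh_psi_neq c l : (1 < m)%N ->
  0 < c -> mu c = 0 -> 0 < l -> l <> c -> rayleigh pi nu (psif l) <> c.
Proof.
move=> m_gt1 c_gt0 mu0 l_gt0 l_neq /(rayleigh_eq c_gt0 mu0 (psi_nonconstant l_gt0)).
move=> [d d_slope].
have psi_slope j : (j < m)%N ->
    psi l j.+1 - psi l j = d * (psi c j.+1 - psi c j).
  move=> jm; rewrite -d_slope //.
  have jm1 : (j < m.+1)%N by rewrite ltnW.
  by rewrite (ext0_ord _ (Ordinal jm1)) (@ext0_ord _ _ _ (Ordinal (jm : (j.+1 < m.+1)%N))).
have flux_slope j : (j < m)%N -> flux l j = d * flux c j.
  by move=> jm; rewrite /flux psi_slope // mulrA.
have drive0 x : drive x 0 = x * (p 0%N * a).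
  by rewrite /drive partial_meanS /partial_mean big_ord0 /=; ring.
have p0a : 0 < p 0%N * a by rewrite mulr_gt0 ?p_gt0.
have dE : l = d * c.
  have := flux_slope 0%N m_gt0; rewrite !flux0 // !drive0 => h.
  by apply: (mulIf (lt0r_neq0 p0a)); rewrite h mulrA.
have d_gt0 : 0 < d by rewrite -(pmulr_lgt0 _ c_gt0) -dE.
have mu_le0 : mu c <= 0 by rewrite mu0.
have [fc1 dc1] := flux_of_mean_le0 c_gt0 mu_le0 m_gt1.
have fl1 : flux l 1 = drive l 1.
  case: (flux_dichotomy l_gt0 m_gt1) => [[]//|[f0 _ _]].
  by have := flux_slope 1%N m_gt1; rewrite f0 fc1 => /esym/eqP;
    rewrite mulf_eq0 !gt_eqF.
have p1 : 0 < p 1%N by rewrite p_gt0.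
have psi1 : psi l 1 = psi c 1.
  have := flux_slope 1%N m_gt1; rewrite fl1 fc1 !driveS !drive0 dE => h.
  have dcp : d * c * p 1%N != 0 by rewrite !mulf_neq0 ?lt0r_neq0.
  by apply: (mulfI dcp); move: h; lra.
have := psi_slope 0%N m_gt0; rewrite psi1.
have := psi_lt_of_mean_le0 c_gt0 mu_le0 m_gt0; rewrite -subr_gt0.
have -> : psi l 0 = psi c 0 by [].
move=> /lt0r_neq0 D0 h; apply: l_neq; rewrite dE.
suff -> : d = 1 by rewrite mul1r.
by apply: (mulIf D0); rewrite mul1r.
Qed.

(** * The iteration *)

Lemma spectral_gap_gt0 : 0 < @spectral_gap R m.+1 pi nu.
Proof. by have [c c_gt0 mu0] := exists_mean_zero; rewrite (spectral_gapE c_gt0). Qed.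

Lemma mean_psi_gap : mu (@spectral_gap R m.+1 pi nu) = 0.
Proof. by have [c c_gt0 mu0] := exists_mean_zero; rewrite (spectral_gapE c_gt0). Qed.

Lemma spectral_gap_le (f : 'I_m.+1 -> R) :
  nonconstant f -> @spectral_gap R m.+1 pi nu <= rayleigh pi nu f.
Proof. by apply: rayleigh_ge; rewrite ?spectral_gap_gt0 ?mean_psi_gap. Qed.

Lemma rayleigh_psi_decr l :
  @spectral_gap R m.+1 pi nu < l -> rayleigh pi nu (psif l) < l.
Proof.
move=> gap_l; have l_gt0 := lt_trans spectral_gap_gt0 gap_l.
apply: rayleigh_psi_lt => //; rewrite ltNge; apply/negP => mu_le0.
have := rayleigh_ge l_gt0 mu_le0 (psi_nonconstant spectral_gap_gt0).
by rewrite rayleigh_psi_eq ?spectral_gap_gt0 ?mean_psi_gap // leNgt gap_l.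
Qed.

Lemma rayleigh_psi_continuous l :
  0 < l -> {for l, continuous (fun l => rayleigh pi nu (psif l))}.
Proof.
move=> l_gt0; have psif_cont i : {for l, continuous (fun x => psif x i)}.
  exact: psi_continuous.
have sum_cont (I : finType) (F : I -> R -> R) :
    (forall i, {for l, continuous (F i)}) ->
    {for l, continuous (fun x => \sum_i F i x)}.
  move=> F_cont; apply: cvg_big => [|i _]; first exact: add_continuous.
  exact: F_cont.
apply: cvgM.
  apply: sum_cont => j; apply: cvgMr_tmp.
  by apply: cvgM; apply: cvgB; exact: psif_cont.
apply: cvgV; first by rewrite gt_eqF // variance_gt0 //; exact: psi_nonconstant.
apply: cvgB.
  apply: sum_cont => i; apply: cvgMr_tmp.
  by apply: cvgM; exact: psif_cont.
by apply: cvgM; exact: mean_psi_continuous.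
Qed.

Section Iterates.
Variable l0 : R.
Hypothesis l0_gt0 : 0 < l0.

Local Notation gap := (@spectral_gap R m.+1 pi nu).
Local Notation lam := (@lambda_seq R m.+1 pi nu a l0).

Lemma lambda_gt0 k : 0 < lam k.
Proof.
elim: k => [//|k IH] /=; apply: lt_le_trans spectral_gap_gt0 _.
by apply: spectral_gap_le; apply: psi_nonconstant.
Qed.

Lemma lambda_fixed : l0 = gap -> forall k, lam k = gap.
Proof.
move=> l0E; elim=> [//|k IH] /=; rewrite IH.
by apply: rayleigh_psi_eq; [exact: spectral_gap_gt0 | exact: mean_psi_gap].
Qed.

Lemma lambda_neq k : (1 < m)%N -> l0 <> gap -> lam k <> gap.
Proof.
move=> m_gt1 l0_neq; elim: k => [//|k IH] /=.
apply: rayleigh_psi_neq => //; first exact: spectral_gap_gt0.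
  exact: mean_psi_gap.
exact: lambda_gt0.
Qed.

Lemma lambda_gt_gap k : (1 < m)%N -> l0 <> gap -> gap < lam k.+1.
Proof.
move=> m_gt1 l0_neq; rewrite lt_def; apply/andP; split.
  by apply/eqP; apply: lambda_neq.
by apply/spectral_gap_le/psi_nonconstant/lambda_gt0.
Qed.

Lemma lambda_decr k : (1 < m)%N -> l0 <> gap -> lam k.+2 < lam k.+1.
Proof. by move=> m_gt1 l0_neq; apply: rayleigh_psi_decr; exact: lambda_gt_gap. Qed.

(** The shift by one matters: the initial value l0 may lie below the gap, and
only from the first iterate on is the sequence decreasing and bounded below by
the gap. *)
Lemma lambda_cvg : (1 < m)%N -> lam k @[k --> \oo] --> gap.
Proof.
move=> m_gt1; have [l0E|/eqP l0_neq] := eqVneq l0 gap.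
  under eq_fun do rewrite lambda_fixed //; exact: cvg_cst.
have decr : {homo (fun k => lam k.+1) : k k' / (k <= k')%N >-> k' <= k}.
  by apply/nonincreasing_seqP => k; apply/ltW/lambda_decr.
have bounded : has_lbound (range (fun k => lam k.+1)).
  by exists gap => _ [k _ <-]; apply/ltW/lambda_gt_gap.
have cvg1 := nonincreasing_is_cvgn decr bounded.
set L := limn (fun k => lam k.+1) in cvg1.
have gap_le_L : gap <= L.
  by apply: limr_ge => //; near=> k; apply/ltW/lambda_gt_gap.
have L_gt0 : 0 < L := lt_le_trans spectral_gap_gt0 gap_le_L.
have L_fixed : rayleigh pi nu (psif L) = L.
  have cvg2 : lam k.+2 @[k --> \oo] --> rayleigh pi nu (psif L).
    exact: continuous_cvg (rayleigh_psi_continuous L_gt0) cvg1.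
  have cvg2' : lam k.+2 @[k --> \oo] --> L.
    by rewrite (cvg_shiftS (fun k => lam k.+1)).
  exact: (cvg_unique _ cvg2 cvg2').
have -> : gap = L.
  apply/eqP; move: gap_le_L; rewrite le_eqVlt => /orP[//|/rayleigh_psi_decr].
  by rewrite L_fixed ltxx.
by rewrite -(cvg_shiftS lam).
Unshelve. all: by end_near.
Qed.

End Iterates.
End Psi.
End Path.

(** On two points variance and energy are both multiples of the square of the
only increment. *)
Lemma rayleigh_two_points {R : realType} (pi : 'I_2 -> R) (nu : 'I_1 -> R)
    (f : 'I_2 -> R) :
  (forall i, 0 < pi i) -> \sum_i pi i = 1 -> nonconstant f ->
  @rayleigh R 2 pi nu f = nu ord0 / (pi ord0 * pi ord_max).
Proof.
move=> pi_gt0 pi_sum f_nc.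
have := variance_gt0 pi_gt0 pi_sum f_nc.
have e1 : lift ord0 ord0 = ord_max :> 'I_2 by apply/val_inj.
have varE : variance pi f = pi ord0 * pi ord_max * (f ord0 - f ord_max) ^+ 2.
  move: pi_sum; rewrite /variance /mean !big_ord_recl !big_ord0 e1 !addr0 => h.
  have -> : pi ord0 = 1 - pi ord_max by rewrite -h addrK.
  by ring.
have dirE : @dirichlet R 2 nu f f = nu ord0 * (f ord0 - f ord_max) ^+ 2.
  rewrite /dirichlet /= big_ord_recl big_ord0 addr0.
  have -> : edge_lo (n := 2) ord0 = ord0 by apply/val_inj.
  have -> : edge_hi (n := 2) ord0 = ord_max by apply/val_inj.
  by ring.
rewrite /rayleigh varE dirE pmulr_rgt0; last exact: mulr_gt0.
move=> D_gt0.
have p0 := lt0r_neq0 (pi_gt0 ord0); have p1 := lt0r_neq0 (pi_gt0 ord_max).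
by field; rewrite p0 p1 /= -sqrf_eq0 gt_eqF.
Qed.

Theorem theorem1p2 (R : realType) (n : nat) (hn : (2 <= n)%N)
  (pi : 'I_n -> R) (nu : 'I_n.-1 -> R)
  (pi_gt0 : forall i, 0 < pi i) (pi_sum : \sum_i pi i = 1)
  (nu_gt0 : forall j, 0 < nu j)
  (l0 a : R) (l0_gt0 : 0 < l0) (a_gt0 : 0 < a) :
  let lG := spectral_gap pi nu in
  let lam := lambda_seq pi nu a l0 in
  let psi := psi_seq pi nu a l0 in
  (n = 2%N -> forall k : nat, (1 <= k)%N -> lam k = lG) /\
  ((3 <= n)%N ->
     (l0 = lG -> forall k : nat, lam k = lG) /\
     (l0 <> lG -> forall k : nat, (1 <= k)%N -> lG < lam k.+1 /\ lam k.+1 < lam k) /\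
     (exists (lstar : R) (psistar : 'I_n -> R),
        lam k @[k --> \oo] --> lstar /\
        (forall i, psi k i @[k --> \oo] --> psistar i) /\
        lstar = rayleigh pi nu psistar /\
        rayleigh pi nu psistar = lG /\
        mean pi psistar = 0)).
Proof.
case: n hn pi nu pi_gt0 pi_sum nu_gt0 => [//|m] hm pi nu pi_gt0 pi_sum nu_gt0 /=.
have m_gt0 : (0 < m)%N by [].
have gap_gt0 := spectral_gap_gt0 m_gt0 pi_gt0 pi_sum nu_gt0 a_gt0.
have mean_gap := mean_psi_gap m_gt0 pi_gt0 pi_sum nu_gt0 a_gt0.
have gap_attained := rayleigh_psi_eq m_gt0 pi_gt0 pi_sum nu_gt0 a_gt0 gap_gt0 mean_gap.
split=> [[m1] [//|k] _|m_gt1].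
  have lam_gt0 := lambda_gt0 m_gt0 pi_gt0 pi_sum nu_gt0 a_gt0 l0_gt0 k.
  have nc l := @psi_nonconstant _ _ pi nu m_gt0 pi_gt0 nu_gt0 a a_gt0 l.
  rewrite -[RHS]gap_attained /=.
  move: (nc _ lam_gt0) (nc _ gap_gt0).
  move: (psi_of _ _ _ _) (psi_of _ _ _ _) => f g {nc mean_gap gap_attained gap_gt0 lam_gt0}.
  move: f g m_gt0; subst m => f g _ f_nc g_nc.
  by rewrite !rayleigh_two_points.
split; first exact: lambda_fixed.
split=> [l0_neq [//|k] _|].
  split.
    exact: (lambda_gt_gap m_gt0 pi_gt0 pi_sum nu_gt0 a_gt0 l0_gt0 k.+1 m_gt1).
  exact: (lambda_decr m_gt0 pi_gt0 pi_sum nu_gt0 a_gt0 l0_gt0 k m_gt1).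
have lam_cvg := lambda_cvg m_gt0 pi_gt0 pi_sum nu_gt0 a_gt0 l0_gt0 m_gt1.
exists (spectral_gap pi nu), (psi_of pi nu a (spectral_gap pi nu)).
split=> //; split; last by [].
move=> i; exact: (continuous_cvg _ (@psi_continuous _ _ pi nu a i _) lam_cvg).
Qed.
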